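(* Let $J$ be a finite set of key positions, let $I_{\mathrm{vis}}\subseteq J$, and let $(\alpha_j)_{j\in J}$ be fixed attention weights, $\alpha_j\ge 0$, $\sum_{j\in J}\alpha_j=1$. Put $\mathrm{VAR}=\sum_{j\in I_{\mathrm{vis}}}\alpha_j$. Let $G\in\mathbb{R}^{d}$ with $\|G\|_2>0$ and let $V>0$. Call a family $(v_j)_{j\in I_{\mathrm{vis}}}$ of vectors in $\mathbb{R}^d$ feasible if $\|v_j\|_2\le V$ for all $j\in I_{\mathrm{vis}}$, and define its first-order visual-route effect by $\widehat\Delta^{\mathrm{vis}}(v)=\sum_{j\in I_{\mathrm{vis}}}\alpha_j\langle G,v_j\rangle$. Then there exist two feasible families $(v_j)_{j\in I_{\mathrm{vis}}}$ and $(v'_j)_{j\in I_{\mathrm{vis}}}$ (with the same attention weights $\alpha$) such that $$\widehat\Delta^{\mathrm{vis}}(v)=+V\|G\|_2\,\mathrm{VAR},\qquad \widehat\Delta^{\mathrm{vis}}(v')=-V\|G\|_2\,\mathrm{VAR}.$$ Consequently, a quantity that depends only on the attention weights (such as $\mathrm{VAR}$) cannot in general identify the sign of the first-order visual-route effect: if $\mathrm{VAR}>0$, there is no function $s$ of the weights $\alpha$ alone such that $s(\alpha)=\mathrm{sign}\,\widehat\Delta^{\mathrm{vis}}(v)$ for all feasible families $v$.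
   Context: Interpretation: one attention head and one query position of a transformer are fixed; $\alpha_j$ is the attention weight on key position $j$ (determined by queries and keys, not by values), $I_{\mathrm{vis}}$ is the set of visual token positions, $v_j$ is the value vector at position $j$, and $G$ is the sensitivity vector (gradient of a scalar decision score with respect to the head output at this query position). *)

(* Defs.v *)
From mathcomp Require Import all_boot all_order all_algebra.
From mathcomp Require Import reals.

Set Implicit Arguments.
Unset Strict Implicit.
Unset Printing Implicit Defensive.

Import Order.TTheory GRing.Theory Num.Theory.
Local Open Scope ring_scope.

(* The dot product [dotmx] of spectral.v is only available over a
   numClosedFieldType, and the library norm on 'rV[R]_d is the sup norm; the
   Euclidean structure on R^d is therefore spelled out here. *)
Definition dotv (R : realType) (d : nat) (x y : 'rV[R]_d) : R :=
  \sum_(i < d) x 0 i * y 0 i.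

Definition l2norm (R : realType) (d : nat) (x : 'rV[R]_d) : R :=
  Num.sqrt (\sum_(i < d) x 0 i ^+ 2).

Definition attention_weights (R : realType) (J : finType) (alpha : J -> R) :
    Prop :=
  (forall j, 0 <= alpha j) /\ \sum_(j : J) alpha j = 1.

Definition VAR (R : realType) (J : finType) (Ivis : {set J}) (alpha : J -> R) :
    R :=
  \sum_(j in Ivis) alpha j.

(* A family of vectors indexed by Ivis is encoded as a total function on J;
   [feasible] and [vis_effect] only look at its values on Ivis. *)
Definition feasible (R : realType) (J : finType) (Ivis : {set J}) (d : nat)
    (V : R) (v : J -> 'rV[R]_d) : Prop :=
  forall j, j \in Ivis -> l2norm (v j) <= V.

Definition vis_effect (R : realType) (J : finType) (Ivis : {set J}) (d : nat)
    (alpha : J -> R) (G : 'rV[R]_d) (v : J -> 'rV[R]_d) : R :=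
  \sum_(j in Ivis) alpha j * dotv G (v j).

(* Main.v *)
(** All value vectors may be taken equal to the multiple of [G] of length [V],
    pointing along [G] or against it: Cauchy-Schwarz is then an equality.  The
    two families share the same weights but have effects of opposite nonzero
    sign. *)

Require Import Defs.
From mathcomp Require Import all_boot all_order all_algebra.
From mathcomp Require Import reals.

Import Order.TTheory GRing.Theory Num.Theory.
Local Open Scope ring_scope.

Lemma sumr_sqr_ge0 (R : realType) (d : nat) (x : 'rV[R]_d) :
  0 <= \sum_(i < d) x 0 i ^+ 2.
Proof. by apply: sumr_ge0 => i _; apply: sqr_ge0. Qed.

Lemma l2normZ (R : realType) (d : nat) (a : R) (x : 'rV[R]_d) :
  l2norm (a *: x) = `|a| * l2norm x.
Proof.
rewrite /l2norm -sqrtr_sqr -sqrtrM ?sqr_ge0 // mulr_sumr.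
by congr Num.sqrt; apply: eq_bigr => i _; rewrite mxE exprMn.
Qed.

Lemma dotvZr (R : realType) (d : nat) (a : R) (x y : 'rV[R]_d) :
  dotv x (a *: y) = a * dotv x y.
Proof.
by rewrite /dotv mulr_sumr; apply: eq_bigr => i _; rewrite mxE mulrCA.
Qed.

Lemma dotvv (R : realType) (d : nat) (x : 'rV[R]_d) :
  dotv x x = l2norm x ^+ 2.
Proof.
by rewrite /l2norm sqr_sqrtr ?sumr_sqr_ge0 //; apply: eq_bigr => i _; rewrite expr2.
Qed.

Lemma vis_effect_cst (R : realType) (J : finType) (Ivis : {set J}) (d : nat)
    (alpha : J -> R) (G w : 'rV[R]_d) :
  vis_effect Ivis alpha G (fun=> w) = dotv G w * VAR Ivis alpha.
Proof. by rewrite /vis_effect /VAR -mulr_suml mulrC. Qed.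

(** Here [c] is a signed length: after normalizing [G], the norm of the vector is the absolute value
    of [c]. Bounding that absolute value lets one lemma serve both [c = V] and [c = - V]. *)
Lemma feasible_aligned (R : realType) (J : finType) (Ivis : {set J}) (d : nat)
    (G : 'rV[R]_d) (c V : R) :
  0 < l2norm G -> `|c| <= V -> feasible Ivis V (fun=> (c / l2norm G) *: G).
Proof.
move=> G0 cV j _; rewrite l2normZ normrM normfV (gtr0_norm G0).
by rewrite divfK // gt_eqF.
Qed.

(** Since [dotv G G] is the square of [l2norm G], the normalization cancels one factor and leaves
    the other, with the sign of [c] intact. *)
Lemma vis_effect_aligned (R : realType) (J : finType) (Ivis : {set J})
    (d : nat) (alpha : J -> R) (G : 'rV[R]_d) (c : R) :
  0 < l2norm G ->
  vis_effect Ivis alpha G (fun=> (c / l2norm G) *: G) =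
  c * l2norm G * VAR Ivis alpha.
Proof.
move=> G0; rewrite vis_effect_cst dotvZr dotvv expr2 mulrA.
by rewrite divfK // gt_eqF.
Qed.

Theorem theoremA6 (R : realType) (J : finType) (Ivis : {set J})
    (alpha : J -> R) (halpha : attention_weights alpha)
    (d : nat) (G : 'rV[R]_d) (hG : 0 < l2norm G) (V : R) (hV : 0 < V) :
  (exists v v' : J -> 'rV[R]_d,
     [/\ feasible Ivis V v,
         feasible Ivis V v',
         vis_effect Ivis alpha G v = V * l2norm G * VAR Ivis alpha &
         vis_effect Ivis alpha G v' = - (V * l2norm G * VAR Ivis alpha)]) /\
  (0 < VAR Ivis alpha ->
   ~ (exists s : (J -> R) -> R,
        forall v : J -> 'rV[R]_d, feasible Ivis V v ->
          s alpha = Num.sg (vis_effect Ivis alpha G v))).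
Proof.
have [v [v' [fv fv' ev ev']]] : exists v v' : J -> 'rV[R]_d,
    [/\ feasible Ivis V v, feasible Ivis V v',
        vis_effect Ivis alpha G v = V * l2norm G * VAR Ivis alpha &
        vis_effect Ivis alpha G v' = - (V * l2norm G * VAR Ivis alpha)].
  exists (fun=> (V / l2norm G) *: G), (fun=> (- V / l2norm G) *: G).
  split; rewrite ?vis_effect_aligned ?mulNr //;
    (* The preceding [mulNr] also moved the sign out of the second family's coefficient; it is put
       back to match [c / l2norm G] with [c = - V]. *)
    by rewrite -?mulNr; apply: feasible_aligned; rewrite ?normrN ?gtr0_norm.
split; first by exists v, v'.
(* Strict positivity keeps the two signs apart: for a zero effect both would be [0]. *)
move=> VAR0 [s hs]; have E0 : 0 < V * l2norm G * VAR Ivis alpha.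
  by rewrite !mulr_gt0.
(* The single value [s alpha] must equal both signs, so [1 = - 1], which [eqNr] turns into
   [1 = 0]. *)
have := hs _ fv'; rewrite (hs _ fv) ev ev' sgrN gtr0_sg // => /eqP.
by rewrite eq_sym eqNr oner_eq0.
Qed.
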